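(* Let $G$ be an $r$-regular graph (not necessarily bipartite) on $n$ vertices, with $r\ge1$, and let $\lambda_1=r\ge\lambda_2\ge\dots\ge\lambda_n$ be the eigenvalues of its adjacency matrix. Then $$\tfrac12\varphi_H(G)\ \le\ \widehat h(B_0(G)),$$ with equality if and only if $\lambda_2=r$ or $\lambda_2+\lambda_n+2=0$.
   Context: Graphs are finite and simple. For a graph $G$ on $n$ vertices with Laplacian eigenvalues $0=\mu_1\le\mu_2\le\dots\le\mu_n$ (the Laplacian being the diagonal degree matrix minus the adjacency matrix), $\varphi_H(G)=\frac n2\big(1-\frac{\mu_2}{\mu_n}\big)$; for $G$ $r$-regular, $\frac12\varphi_H(G)=\frac n4\,\frac{\lambda_2-\lambda_n}{r-\lambda_n}$. The extended bipartite double $B_0(G)$ of $G=(V,E)$ is the bipartite graph with bipartition $V\cup V'$, where $V'=\{i':i\in V\}$ is a disjoint copy of $V$, whose edges are $\{i,j'\}$ and $\{j,i'\}$ for $\{i,j\}\in E$ and $\{i,i'\}$ for $i\in V$. For a bipartite graph $H$ with bipartition $W_1\cup W_2$ and adjacency matrix $A_H$, $\widehat h(H)=\min_{\lambda,t\in\mathbb R}\{\lambda:\lambda I+tA_H-C\succeq0\}$, where $C$ is the symmetric matrix indexed by $W_1\cup W_2$ with entries $\frac12$ at positions with indices on different sides of the bipartition and $0$ elsewhere. If $H$ is $d$-regular ($d\ge1$) with $|W_1|=|W_2|=m\ge2$, then $\widehat h(H)=\frac m2\frac{\lambda_2(A_H)}{d+\lambda_2(A_H)}$, where $\lambda_2(A_H)$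 is the second largest eigenvalue of $A_H$; thus $$\widehat h(B_0(G))=\frac n2\,\frac{\max\{\lambda_2+1,-\lambda_n-1\}}{\max\{\lambda_2+1,-\lambda_n-1\}+r+1}.$$ *)

(* Defs.v *)
From HB Require Import structures.
From mathcomp Require Import all_boot all_order all_algebra.
From mathcomp Require Import all_classical all_reals.
From mathcomp Require Import complex spectral.
From mathcomp Require Import ring lra.

Set Implicit Arguments.
Unset Strict Implicit.
Unset Printing Implicit Defensive.

Import Order.TTheory GRing.Theory Num.Theory.

Local Open Scope ring_scope.

Record sgraph := SGraph {
  vertex :> finType;
  adj : rel vertex;
  adj_sym : symmetric adj;
  adj_irr : irreflexive adj }.

Definition degree (G : sgraph) (x : G) : nat := #|[set y : G | adj x y]|.

Definition regular (G : sgraph) (r : nat) : Prop :=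
  forall x : G, degree x = r.

(* A graph with a fixed bipartition W1 = {side = false}, W2 = {side = true}. *)
Record bigraph := BiGraph {
  bigraph_graph :> sgraph;
  side : bigraph_graph -> bool;
  adj_side : forall x y : bigraph_graph, adj x y -> side x != side y }.

Section ExtendedBipartiteDouble.
Variable G : sgraph.

Definition B0_adj : rel (G + G)%type := fun x y =>
  match x, y with
  | inl i, inr j | inr j, inl i => (i == j) || adj i j
  | _, _ => false
  end.

Fact B0_adj_sym : symmetric B0_adj.
Proof. by case=> i [] j. Qed.

Fact B0_adj_irr : irreflexive B0_adj.
Proof. by case. Qed.

Definition B0_graph := SGraph B0_adj_sym B0_adj_irr.

Definition B0_side (x : B0_graph) : bool := if x is inl _ then false else true.

Fact B0_adj_side (x y : B0_graph) : adj x y -> B0_side x != B0_side y.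
Proof. by case: x y => i [] j. Qed.

Definition B0 : bigraph := BiGraph B0_adj_side.

End ExtendedBipartiteDouble.

(* Matrices of a graph are indexed by 'I_#|G| through the enumeration
   enum_val of the vertices. *)
Section GraphMatrices.
Variables (R : realType) (G : sgraph).

Definition adjmx : 'M[R]_#|G| :=
  \matrix_(i, j) (adj (enum_val i) (enum_val j))%:R.

Definition degmx : 'M[R]_#|G| :=
  diag_mx (\row_i (degree (enum_val i))%:R).

Definition laplacian : 'M[R]_#|G| := degmx - adjmx.

Lemma adjmx_sym : adjmx^T = adjmx.
Proof. by apply/matrixP => i j; rewrite !mxE adj_sym. Qed.

Lemma laplacian_sym : laplacian^T = laplacian.
Proof. by rewrite /laplacian linearB /= adjmx_sym tr_diag_mx. Qed.

End GraphMatrices.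

Section Spectrum.
Variable R : realType.

Definition is_spectrum n (M : 'M[R]_n) (s : seq R) : Prop :=
  sorted (fun x y => y <= x) s /\ char_poly M = \prod_(a <- s) ('X - a%:P).

(* The nonincreasing list of eigenvalues, with multiplicity. It exists for
   symmetric matrices by spectrumP below; [::] is a dummy value for matrices
   whose characteristic polynomial does not split over R. *)
Definition spectrum n (M : 'M[R]_n) : seq R := xget [::] (is_spectrum M).

(* k-th largest and k-th smallest eigenvalue, with k counted from 1. *)
Definition eig_desc n (M : 'M[R]_n) (k : nat) : R := (spectrum M)`_k.-1.
Definition eig_asc n (M : 'M[R]_n) (k : nat) : R := (rev (spectrum M))`_k.-1.

Lemma is_spectrum_uniq n (M : 'M[R]_n) s t :
  is_spectrum M s -> is_spectrum M t -> s = t.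
Proof.
move=> [ss sM] [st tM]; apply: (sorted_eq _ _ ss st).
- by move=> y x z yx zy; apply: le_trans zy yx.
- by move=> x y /andP[yx xy]; apply: le_anti; rewrite xy yx.
- apply: prod_XsubC_eq; exact: etrans (esym sM) tM.
Qed.

Lemma spectrumP n (M : 'M[R]_n) : M^T = M -> is_spectrum M (spectrum M).
Proof.
move=> Msym; suff Mex : exists s, is_spectrum M s.
  exact: (@xgetPex _ [::] (is_spectrum M)).
pose f := real_complex R; pose N := map_mx f M.
have Nherm : N \is hermsymmx.
  apply: realsym_hermsym.
    by apply/is_hermitianmxP; rewrite expr0 scale1r map_mx_id // /N map_trmx Msym.
  by apply/mxOverP => i j; rewrite mxE complex_real.
have := hermitian_spectral_diag_real Nherm.
have /orthomx_spectralP := hermitian_normalmx Nherm.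
set P := spectralmx N; set d := spectral_diag N => NE dreal.
pose e i := complex.Re (d 0 i).
have dE i : d 0 i = f (e i).
  by have /mxOverP/(_ 0 i) := dreal; move=> /RRe_real /esym.
have Pu : P \in unitmx := spectral_unit N.
have charN : char_poly N = \prod_i ('X - (d 0 i)%:P).
  have -> : char_poly N = char_poly (diag_mx d).
    have -> : char_poly N = \det (map_mx polyC (invmx P) *m
        char_poly_mx (diag_mx d) *m map_mx polyC P).
      rewrite /char_poly [in LHS]NE /char_poly_mx; congr (\det _).
      rewrite mulmxBr mulmxBl !map_mxM /= scalar_mxC -mulmxA.
      by congr (_ - _); rewrite -mulmxA -map_mxM mulVmx // map_mx1 mulmx1.
    rewrite !det_mulmx mulrAC -det_mulmx -map_mxM mulVmx //.
    by rewrite map_mx1 det1 mul1r.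
  rewrite char_poly_trig ?diag_mx_is_trig //; apply: eq_bigr => i _.
  by rewrite mxE eqxx mulr1n.
have charM : char_poly M = \prod_(a <- [seq e i | i : 'I_n]) ('X - a%:P).
  apply: (@map_poly_inj _ _ f); rewrite map_char_poly -/N charN.
  rewrite big_image rmorph_prod; apply: eq_bigr => i _.
  by rewrite /= map_polyXsubC dE.
exists (sort (fun x y => y <= x) [seq e i | i : 'I_n]); split.
  by apply: sort_sorted => x y; exact: le_total.
by rewrite charM; apply: perm_big; rewrite perm_sym perm_sort.
Qed.

End Spectrum.

Section GraphInvariants.
Variable R : realType.

Definition psd n (M : 'M[R]_n) : Prop :=
  M^T = M /\ forall x : 'cV[R]_n, 0 <= (x^T *m M *m x) 0 0.

Definition phiH (G : sgraph) : R :=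
  #|G|%:R / 2 *
  (1 - eig_asc (laplacian R G) 2%N / eig_asc (laplacian R G) #|G|).

Definition crossmx (H : bigraph) : 'M[R]_#|H| :=
  \matrix_(i, j)
    if side (enum_val i) != side (enum_val j) then 2^-1 else 0.

Definition hhat_feasible (H : bigraph) (lam t : R) : Prop :=
  psd (lam%:M + t *: adjmx R H - crossmx H).

(* The infimum is a minimum by hhatP below. *)
Definition hhat (H : bigraph) : R :=
  inf [set lam : R | exists t : R, hhat_feasible H lam t]%classic.

Fact strip_min (X : Type) (a b c : X -> R)
    (S := [set l : R | exists t, forall x, c x <= l * a x + t * b x]%classic) :
  (forall x, 0 <= a x) -> (forall x, exists y, b y = - b x) ->
  has_inf S -> S (inf S).
Proof.
move=> a_ge0 flip infS; pose l0 := inf S.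
have near e : 0 < e -> exists t, forall x, c x <= (l0 + e) * a x + t * b x.
  move=> /inf_adherent/(_ infS) [l [t lt] ll0]; exists t => x.
  by apply: le_trans (lt x) _; rewrite lerD2r ler_wpM2r // ltW.
have lim (u v w : R) : 0 <= w -> (forall e, 0 < e -> u <= v + w * e) -> u <= v.
  move=> w_ge0 uvw; apply/ler_addgt0Pr => e e_gt0.
  have w1_gt0 : 0 < w + 1 by rewrite ltr_wpDl.
  apply: le_trans (uvw (e / (w + 1)) (divr_gt0 e_gt0 w1_gt0)) _.
  by rewrite lerD2l mulrCA ger_pMr // ler_pdivrMr // mul1r lerDl.
have zero x : b x = 0 -> c x <= l0 * a x.
  move=> bx0; apply: (lim _ _ (a x)) => // e /near[t /(_ x)].
  by rewrite bx0 mulr0 addr0 mulrDl [e * _]mulrC.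
have pair x y : 0 < b x -> b y < 0 ->
    (c x - l0 * a x) / b x <= (c y - l0 * a y) / b y.
  move=> bx_gt0 by_lt0; rewrite ler_pdivrMr // mulrAC ler_ndivlMr //.
  apply: (lim _ _ (a y * b x - a x * b y)).
    by rewrite subr_ge0 (@le_trans _ _ 0) // ?mulr_ge0 ?mulr_ge0_le0 // ltW.
  move=> e /near[t te]; have := te x; have := te y; nra.
have [[x0 bx0]|nopos] := pselect (exists x, 0 < b x); last first.
  exists 0 => x; rewrite mul0r addr0; apply: zero; apply: le_anti.
  have [y byx] := flip x; apply/andP; split; rewrite leNgt; apply/negP => bx.
    by apply: nopos; exists x.
  by apply: nopos; exists y; rewrite byx oppr_gt0.
pose T := [set (c x - l0 * a x) / b x | x in [set x | 0 < b x]]%classic.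
have [y0 by0] := flip x0.
have T_sup : has_sup T.
  split; first by exists ((c x0 - l0 * a x0) / b x0); exists x0.
  exists ((c y0 - l0 * a y0) / b y0) => _ [x bx <-].
  by apply: pair; rewrite // by0 oppr_lt0.
exists (sup T) => x; rewrite -/l0 -lerBlDl.
have [bx|bx|bx] := ltgtP (b x) 0.
- rewrite -ler_ndivlMr //; apply: ge_sup; first exact: T_sup.1.
  by move=> _ [z bz <-]; exact: pair.
- rewrite -ler_pdivrMr //; apply: ub_le_sup; first exact: T_sup.2.
  by exists x.
- by rewrite bx mulr0 subr_le0 zero.
Qed.

Theorem hhatP (H : bigraph) : (0 < #|H|)%N ->
  (exists t, hhat_feasible H (hhat H) t) /\
  (forall lam t, hhat_feasible H lam t -> hhat H <= lam).
Proof.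
move=> H_gt0; pose q (M : 'M[R]_#|H|) (x : 'cV[R]_#|H|) := (x^T *m M *m x) 0 0.
pose n2 (x : 'cV[R]_#|H|) := \sum_i x i 0 ^+ 2.
have qE M x : q M x = \sum_i \sum_j x i 0 * M i j * x j 0.
  rewrite /q mxE exchange_big; apply: eq_bigr => j _; rewrite mxE mulr_suml.
  by apply: eq_bigr => i _; rewrite !mxE.
have q_feas lam t x : q (lam%:M + t *: adjmx R H - crossmx H) x =
    lam * n2 x + t * q (adjmx R H) x - q (crossmx H) x.
  have E00 (A B C : 'M[R]_1) (u v : R) :
    (u *: A + v *: B - C) 0 0 = u * A 0 0 + v * B 0 0 - C 0 0 by rewrite !mxE.
  rewrite /q mulmxBr mulmxDr mulmxBl mulmxDl -scalemx1 -!scalemxAr -!scalemxAl.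
  rewrite mulmx1 E00 [(x^T *m x) 0 0]mxE; congr (_ * _ + _ - _).
  by apply: eq_bigr => i _; rewrite mxE.
have feas_sym lam t : (lam%:M + t *: adjmx R H - crossmx H)^T =
    lam%:M + t *: adjmx R H - crossmx H.
  rewrite linearB linearD linearZ /= tr_scalar_mx adjmx_sym; congr (_ - _).
  by apply/matrixP => i j; rewrite !mxE eq_sym.
have feasP lam t : hhat_feasible H lam t <->
    forall x, q (crossmx H) x <= lam * n2 x + t * q (adjmx R H) x.
  split=> [[_ Hx] x|Hx]; first by rewrite -subr_ge0 -q_feas; exact: Hx.
  by split=> // x; rewrite -/(q _ _) q_feas subr_ge0.
have n2_ge0 x : 0 <= n2 x by apply: sumr_ge0 => i _; exact: sqr_ge0.
have flip x : exists y, q (adjmx R H) y = - q (adjmx R H) x.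
  exists (\col_i ((-1) ^+ side (enum_val i) * x i 0)); rewrite !qE -sumrN.
  apply: eq_bigr => i _; rewrite -sumrN; apply: eq_bigr => j _; rewrite !mxE.
  case Aij: (adj _ _); last by rewrite /= !mulr0 !mul0r oppr0.
  have := adj_side Aij; case: side; case: side => //= _;
    by rewrite expr0 expr1; ring.
pose S := [set l : R | exists t, forall x,
  q (crossmx H) x <= l * n2 x + t * q (adjmx R H) x]%classic.
have hhatE : hhat H = inf S.
  congr inf; apply/seteqP; split=> l [t lt]; exists t; exact/feasP.
have S_inf : has_inf S.
  split.
    exists #|H|%:R, 0 => x; rewrite mul0r addr0 qE.
    have -> : #|H|%:R * n2 x =
        \sum_(i < #|H|) \sum_(j < #|H|) (x i 0 ^+ 2 + x j 0 ^+ 2) / 2.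
      under eq_bigr do rewrite -mulr_suml big_split /= sumr_const card_ord.
      rewrite -mulr_suml big_split /= sumr_const card_ord -sumrMnl -/(n2 x).
      by rewrite sumrMnl -/(n2 x) -mulr_natl; field.
    apply: ler_sum => i _; apply: ler_sum => j _; rewrite mxE.
    by case: ifP => _; have := sqr_ge0 (x i 0 - x j 0);
      have := sqr_ge0 (x i 0); have := sqr_ge0 (x j 0); nra.
  exists 0 => l [t lt]; pose i0 := Ordinal H_gt0.
  have qd M : q M (delta_mx i0 0) = M i0 i0.
    by rewrite /q trmx_delta -rowE -colE !mxE.
  have n2d : n2 (delta_mx i0 0) = 1.
    rewrite /n2 (bigD1 i0) //= big1 ?mxE ?eqxx ?expr1n ?addr0 // => i.
    by rewrite mxE => /negPf ->; rewrite expr0n.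
  by have := lt (delta_mx i0 0); rewrite !qd n2d !mxE eqxx adj_irr mulr0 addr0 mulr1.
split; last first.
  move=> lam t /feasP lt; rewrite hhatE; apply: ge_inf; first exact: S_inf.2.
  by exists t.
have [t tP] := strip_min n2_ge0 flip S_inf.
by exists t; rewrite hhatE; exact/feasP.
Qed.

End GraphInvariants.

(* Main.v *)
Require Import Defs.
From mathcomp Require Import all_boot all_order all_algebra.
From mathcomp Require Import all_reals.
From mathcomp Require Import sesquilinear spectral complex ring lra zify.

(** Write A for the adjacency matrix of G, J for the all-ones matrix, and put
    theta = max (lambda_2 + 1, - lambda_n - 1).  The inequality compares two
    explicit functions of r, lambda_2 and lambda_n.

    Since L = r I - A, the Laplacian spectrum is the reflected adjacency
    spectrum (eig_asc_laplacian), whence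
      phi_H / 2 = n/4 * (lambda_2 - lambda_n) / (r - lambda_n) (half_phiHE).

    The quadratic form of lam I + t A_H - C for H = B_0(G) splits under the
    change of variables p = u + v, m = u - v, where u and v are the two halves
    of a vector (qform_B0).  Hence (lam, t) is feasible exactly when
    the operator J - 2 t (I + A) has norm at most 2 lam
    (hhat_feasible_B0P).  This operator has the eigenvalue n - 2 t (r + 1) on
    the all-ones vector, and - 2 t (mu + 1) on an eigenvector of A orthogonal to
    it.  The all-ones vector gives n/2 <= lam + t (r + 1), the eigenvectors for
    lambda_2 and lambda_n give t theta <= lam, and together these force
      lam >= n/2 * theta / (theta + r + 1);
    equality is reached at t = (n/2) / (theta + r + 1), lam = t theta (hhat_B0E).

    To speak of lambda_2, ..., lambda_n on the orthogonal complement of the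
    all-ones vector, A is deflated: adding a multiple of J moves its eigenvalue
    r to any prescribed b and leaves the other ones in place
    (char_poly_deflated).  With b in [lambda_n, lambda_2], the Rayleigh bounds
    for the deflated matrix yield the wanted bounds
    for A (qform_const_rows_bound); with b different from an eigenvalue a, every
    eigenvector of the deflated matrix for a is orthogonal to the all-ones
    vector (eigenvector_entry_sum0).

    What is left is arithmetic (compare_bounds): the difference of the two
    functions is a positive multiple of (r - lambda_2) (lambda_2 + lambda_n + 2)
    if theta = lambda_2 + 1, and of - (lambda_2 + lambda_n + 2) otherwise. *)

Set Implicit Arguments.
Unset Strict Implicit.
Unset Printing Implicit Defensive.

Import Order.TTheory GRing.Theory Num.Theory.

Local Open Scope ring_scope.

(** * Quadratic forms of real symmetric matrices *)

Section QuadraticForms.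
Variable R : realType.

Definition qform n (M : 'M[R]_n) (x : 'cV[R]_n) : R := (x^T *m M *m x) 0 0.
Definition sqnorm n (x : 'cV[R]_n) : R := \sum_i x i 0 ^+ 2.
Definition entry_sum n (x : 'cV[R]_n) : R := \sum_i x i 0.

Lemma qformE n (M : 'M[R]_n) x :
  qform M x = \sum_i \sum_j M i j * (x i 0 * x j 0).
Proof.
rewrite /qform mxE exchange_big; apply: eq_bigr => j _; rewrite mxE mulr_suml.
by apply: eq_bigr => i _; rewrite !mxE [x i 0 * _]mulrC mulrA.
Qed.

Lemma sqnormE_delta m (p : 'cV[R]_m) :
  sqnorm p = \sum_i \sum_j (i == j)%:R * (p i 0 * p j 0).
Proof.
apply: eq_bigr => i _; rewrite (bigD1 i) //= big1 ?eqxx ?addr0 ?mul1r // => j.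
by rewrite eq_sym => /negPf ->; rewrite mul0r.
Qed.

Lemma sqnorm_ge0 n (x : 'cV[R]_n) : 0 <= sqnorm x.
Proof. by apply: sumr_ge0 => i _; exact: sqr_ge0. Qed.

Lemma sqnorm_gt0 n (x : 'cV[R]_n) : x != 0 -> 0 < sqnorm x.
Proof.
move=> x0; rewrite lt0r sqnorm_ge0 andbT; apply: contra x0 => /eqP x0.
apply/eqP/matrixP => i j; rewrite ord1 mxE; apply/eqP; rewrite -sqrf_eq0.
by apply/eqP; apply: psumr_eq0P x0 i _ => // k _; exact: sqr_ge0.
Qed.

Lemma entry_sumD n (x y : 'cV[R]_n) :
  entry_sum (x + y) = entry_sum x + entry_sum y.
Proof. by rewrite /entry_sum -big_split; apply: eq_bigr => i _; rewrite mxE. Qed.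

Lemma entry_sumZ n (a : R) (x : 'cV[R]_n) : entry_sum (a *: x) = a * entry_sum x.
Proof. by rewrite /entry_sum mulr_sumr; apply: eq_bigr => i _; rewrite mxE. Qed.

Lemma entry_sum_const1 n : entry_sum (const_mx 1 : 'cV[R]_n) = n%:R.
Proof.
by rewrite /entry_sum; under eq_bigr do rewrite mxE; rewrite sumr_const card_ord.
Qed.

Lemma entry_sumE n (x : 'cV[R]_n) : entry_sum x = ((const_mx 1 : 'cV_n)^T *m x) 0 0.
Proof. by rewrite mxE; apply: eq_bigr => i _; rewrite !mxE mul1r. Qed.

Lemma qform_eigenvector n (M : 'M[R]_n) a x :
  M *m x = a *: x -> qform M x = a * sqnorm x.
Proof.
move=> Mx; rewrite /qform -mulmxA Mx -scalemxAr !mxE; congr (_ * _).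
by apply: eq_bigr => i _; rewrite mxE.
Qed.

Local Open Scope sesquilinear_scope.

(** Diagonalise M over R[i] by a unitary P: the weights c are the squared moduli
    of the coordinates of P x, so that quadratic forms become weighted averages
    of eigenvalues. *)
Lemma spectral_weights n (M : 'M[R]_n) (x : 'cV[R]_n) : M^T = M ->
  exists e c : 'I_n -> R,
    [/\ forall i, root (char_poly M) (e i), forall i, 0 <= c i,
        \sum_i c i = sqnorm x & \sum_i e i * c i = qform M x].
Proof.
move=> Msym; pose f := real_complex R; pose N := map_mx f M.
have fconj a : (f a)^* = f a by rewrite conj_Creal // complex_real.
have fM : {morph f : a b / a * b} by move=> a b; exact: rmorphM.
have finj : injective f by move=> a b [].
have Nherm : N \is hermsymmx.
  apply: realsym_hermsym.
    by apply/is_hermitianmxP; rewrite expr0 scale1r map_mx_id // /N map_trmx Msym.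
  by apply/mxOverP => i j; rewrite mxE complex_real.
have := hermitian_spectral_diag_real Nherm.
have /orthomx_spectralP := hermitian_normalmx Nherm.
have Punit := spectral_unitarymx N; have Pu := spectral_unit N.
move: Punit Pu; set P := spectralmx N; set d := spectral_diag N.
move=> Punit Pu NE dreal.
pose e i := complex.Re (d 0 i).
have dE i : d 0 i = f (e i).
  by have /mxOverP/(_ 0 i) := dreal; move=> /RRe_real /esym.
pose y := P *m map_mx f x.
pose c i := complex.Re (`|y i 0| ^+ 2).
have cE i : (y i 0)^* * y i 0 = f (c i).
  by rewrite mulrC -normCK; apply/esym/RRe_real; rewrite rpredX // normr_real.
have yE : y^t* = (map_mx f x)^T *m invmx P.
  rewrite /y invmx_unitary // trmx_mul map_mxM /=; congr (_ *m _).
  by apply/matrixP => i j; rewrite !mxE fconj.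
have normE : f (sqnorm x) = \sum_i f (c i).
  transitivity ((y^t* *m y) 0 0).
    rewrite yE mulmxA mulmxKV // map_trmx -map_mxM /= mxE; congr f.
    by rewrite mxE; apply: eq_bigr => i _; rewrite mxE.
  (* y is generalised so that mxE does not unfold the product P *m x. *)
  rewrite mxE; apply: eq_bigr => i _; rewrite -cE.
  by move: (y) => z; rewrite !mxE.
have qE : f (qform M x) = \sum_i f (e i * c i).
  transitivity ((y^t* *m diag_mx d *m y) 0 0).
    rewrite yE /y -!mulmxA.
    have -> : invmx P *m (diag_mx d *m (P *m map_mx f x)) = N *m map_mx f x.
      by rewrite NE !mulmxA.
    by rewrite mulmxA map_trmx /N -!map_mxM /= mxE.
  rewrite mxE; apply: eq_bigr => i _; rewrite mul_mx_diag fM -cE -dE.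
  by move: (y) => z; rewrite !mxE mulrAC mulrC.
exists e, c; split.
- move=> i; rewrite -(fmorph_root f) map_char_poly -/N -eigenvalue_root_char.
  apply/eigenvalueP; exists (row i P).
    rewrite -row_mul NE !mulmxA mulmxV // mul1mx row_mul row_diag_mx -scalemxAl.
    by rewrite -rowE dE.
  by rewrite rowE mulmx_free_eq0 ?row_free_unit // -mxrank_eq0 mxrank_delta.
- by move=> i; rewrite -lecR -/f -cE mulrC -normCK exprn_ge0.
- by apply: finj; rewrite normE; exact: (rmorph_sum (real_complex R)).
- by apply: finj; rewrite qE; exact: (rmorph_sum (real_complex R)).
Qed.

Lemma rayleigh n (M : 'M[R]_n) (lo hi : R) (x : 'cV[R]_n) : M^T = M ->
  (forall a, root (char_poly M) a -> lo <= a <= hi) ->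
  lo * sqnorm x <= qform M x <= hi * sqnorm x.
Proof.
move=> Msym bd; have [e [c [eroot c_ge0 <- <-]]] := spectral_weights x Msym.
rewrite !mulr_sumr; apply/andP; split; apply: ler_sum => i _;
  by have /andP[? ?] := bd _ (eroot i); rewrite ler_wpM2r.
Qed.

End QuadraticForms.

(** * Characteristic polynomials under shifts and rank-one updates *)

(** Brauer's theorem: a rank-one update along an eigenvector moves only the
    eigenvalue of that eigenvector.  Both sides are the determinant of the
    bordered matrix K times X - a, computed after clearing its last column from
    the right (by L), and from its Schur factorisation. *)
Lemma char_poly_rank1_update (F : comNzRingType) n (A : 'M[F]_n) (a : F)
    (v : 'cV[F]_n) (w : 'rV[F]_n) : A *m v = a *: v ->
  ('X - a%:P) * char_poly (A + v *m w) =
  ('X - (a + (w *m v) 0 0)%:P) * char_poly A.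
Proof.
move=> Av; pose B := char_poly_mx A.
pose v' := map_mx polyC v; pose w' := map_mx polyC w.
pose K := block_mx B v' w' 1%:M.
pose L := block_mx (1%:M : 'M_n) (- v') 0 ('X - a%:P)%:M.
have Bv : B *m v' = ('X - a%:P) *: v'.
  rewrite /B /char_poly_mx mulmxBl mul_scalar_mx -map_mxM Av scalerBl.
  by congr (_ - _); apply/matrixP => i j; rewrite !mxE rmorphM.
have wv : w' *m v' = ((w *m v) 0 0)%:P%:M.
  by rewrite -map_mxM [w *m v in LHS]mx11_scalar map_scalar_mx.
have KL : K *m L = block_mx B 0 w' ('X - (a + (w *m v) 0 0)%:P)%:M.
  rewrite mulmx_block !mulmx1 !mulmx0 !addr0 mul1mx !mulmxN Bv wv.
  congr block_mx; first by rewrite mul_mx_scalar addNr.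
  by apply/matrixP => i j; rewrite !ord1 !mxE !mulr1n polyCD; ring.
have KU : K = block_mx (1%:M : 'M_n) v' 0 1%:M *m
    block_mx (char_poly_mx (A + v *m w)) 0 w' 1%:M.
  rewrite mulmx_block !mulmx1 !mul1mx !mul0mx !add0r.
  congr block_mx; rewrite /char_poly_mx map_mxD map_mxM opprD addrA.
  by rewrite subrK.
have := congr1 determinant KL; rewrite det_mulmx KU det_mulmx.
rewrite !det_ublock !det_lblock !det1 !det_scalar1 !mulr1 !mul1r.
by rewrite mulrC => ->; rewrite mulrC.
Qed.

Lemma char_poly_scalar_sub (F : idomainType) n (M : 'M[F]_n) (s : seq F) (c : F) :
  char_poly M = \prod_(a <- s) ('X - a%:P) ->
  char_poly (c%:M - M) = \prod_(a <- s) ('X - (c - a)%:P).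
Proof.
move=> charM.
have size_s : size s = n.
  by have := size_char_poly M; rewrite charM size_prod_XsubC => -[].
have -> : char_poly (c%:M - M) = (-1) ^+ n * (char_poly M \Po (c%:P - 'X)).
  rewrite /char_poly -det_map_mx -detZ; congr (\det _); apply/matrixP => i j.
  rewrite !mxE; case: (i == j); rewrite ?mulr1n ?mulr0n /= comp_polyB;
    by rewrite ?comp_polyX ?comp_polyC ?comp_poly0 ?polyCB ?polyC0; ring.
rewrite charM -size_s {size_s charM}.
elim: s => [|a s IHs]; first by rewrite !big_nil comp_polyC expr0 mulr1.
rewrite !big_cons -IHs comp_polyM comp_polyB comp_polyX comp_polyC exprS polyCB.
by ring.
Qed.

(** * Matrices with constant row sums *)

Section ConstantRowSums.
Variable R : realType.

(** Squared norm of the orthogonal projection of x on the all-ones vector. *)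
Definition mean_sq n (x : 'cV[R]_n) : R := entry_sum x ^+ 2 / n%:R.

Lemma mean_sq_le_sqnorm m (x : 'cV[R]_m) : (0 < m)%N -> mean_sq x <= sqnorm x.
Proof.
move=> m_gt0; have m_neq0 : m%:R != 0 :> R by rewrite pnatr_eq0 -lt0n.
have : 0 <= sqnorm (x - entry_sum x / m%:R *: const_mx 1) := sqnorm_ge0 _.
suff -> : sqnorm (x - entry_sum x / m%:R *: const_mx 1) = sqnorm x - mean_sq x.
  by rewrite subr_ge0.
rewrite {1}/sqnorm; under eq_bigr do rewrite !mxE mulr1 sqrrB.
rewrite big_split sumrB /= sumr_const card_ord -[_ *+ m]mulr_natr.
rewrite -[\sum_(i < m) x i 0 ^+ 2]/(sqnorm x) sumrMnl -mulr_suml.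
by rewrite -/(entry_sum x) /mean_sq -mulr_natr; field.
Qed.

Section Deflation.
Variables (n : nat) (A : 'M[R]_n) (r : R) (s : seq R).
Hypothesis n_gt0 : (0 < n)%N.
Hypothesis A_sym : A^T = A.
Hypothesis A_rows : A *m const_mx 1 = r *: (const_mx 1 : 'cV[R]_n).
Hypothesis char_A : char_poly A = ('X - r%:P) * \prod_(a <- s) ('X - a%:P).

(** A + (b - r) / n J: the multiple of J that turns the row sums r into b. *)
Definition deflated (b : R) : 'M[R]_n :=
  A + (const_mx 1 : 'cV_n) *m (const_mx ((b - r) / n%:R) : 'rV_n).

Lemma deflated_sym b : (deflated b)^T = deflated b.
Proof.
by rewrite /deflated linearD /= A_sym trmx_mul !trmx_const; congr (_ + _);
  apply/matrixP => i j; rewrite !mxE !big_ord1 !mxE mulrC.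
Qed.

Lemma char_poly_deflated b :
  char_poly (deflated b) = ('X - b%:P) * \prod_(a <- s) ('X - a%:P).
Proof.
have n_neq0 : n%:R != 0 :> R by rewrite pnatr_eq0 -lt0n.
have Xr_neq0 : 'X - r%:P != 0 by rewrite polyXsubC_eq0.
apply: (mulfI Xr_neq0).
rewrite char_poly_rank1_update // char_A mulrCA; congr (_ * (('X - _%:P) * _)).
rewrite mxE; under eq_bigr do rewrite !mxE mulr1.
by rewrite sumr_const card_ord -[_ *+ n]mulr_natr divfK // addrC subrK.
Qed.

Lemma root_char_poly_deflated b a :
  root (char_poly (deflated b)) a = (a == b) || (a \in s).
Proof. by rewrite char_poly_deflated rootM root_XsubC root_prod_XsubC. Qed.

Lemma deflated_mul b x : deflated b *m x =
  A *m x + ((b - r) / n%:R * entry_sum x) *: (const_mx 1 : 'cV_n).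
Proof.
rewrite /deflated mulmxDl -mulmxA; congr (_ + _); apply/matrixP => i j.
rewrite !mxE big_ord1 !mxE mul1r mulr1 mulr_sumr; apply: eq_bigr => k _.
by rewrite !mxE (ord1 j).
Qed.

Lemma qform_deflated b x :
  qform (deflated b) x = qform A x + (b - r) * mean_sq x.
Proof.
rewrite /qform -!mulmxA deflated_mul mulmxDr -scalemxAr !mxE; congr (_ + _).
under [X in _ * X]eq_bigr do rewrite !mxE mulr1.
by rewrite -/(entry_sum x) /mean_sq; ring.
Qed.

(** Rayleigh bounds on the orthogonal complement of the all-ones vector.
    Deflating to lo or to hi keeps the whole spectrum within [lo, hi]; the lower
    bound comes from the first choice and the upper bound from the second. *)
Lemma qform_const_rows_bound (lo hi : R) (x : 'cV_n) : lo <= hi ->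
  (forall a, a \in s -> lo <= a <= hi) ->
  r * mean_sq x + lo * (sqnorm x - mean_sq x) <= qform A x
    <= r * mean_sq x + hi * (sqnorm x - mean_sq x).
Proof.
move=> lohi bd.
have ray b : lo <= b <= hi ->
    lo * sqnorm x <= qform (deflated b) x <= hi * sqnorm x.
  move=> bin; apply: rayleigh (deflated_sym b) _ => a.
  by rewrite root_char_poly_deflated => /orP[/eqP ->|/bd].
have /andP[+ _] := ray lo ltac:(by rewrite lexx).
have /andP[_ +] := ray hi ltac:(by rewrite lexx andbT).
rewrite !qform_deflated; lra.
Qed.

(** Deflating to a + 1, which differs from a, leaves a in the spectrum, and an
    eigenvector w for a is then orthogonal to the all-ones vector, which is an
    eigenvector for a + 1.  This also covers the eigenvalue a = r of a
    disconnected graph. *)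
Lemma eigenvector_entry_sum0 a : a \in s ->
  exists w : 'cV_n, [/\ w != 0, entry_sum w = 0 & A *m w = a *: w].
Proof.
move=> sa; have := root_char_poly_deflated (a + 1) a; rewrite sa orbT.
rewrite -eigenvalue_root_char => /eigenvalueP[v vM v0].
have Mw : deflated (a + 1) *m v^T = a *: v^T.
  by rewrite -[deflated _]deflated_sym -trmx_mul vM linearZ.
have w0 : entry_sum v^T = 0.
  have n_neq0 : n%:R != 0 :> R by rewrite pnatr_eq0 -lt0n.
  have := congr1 (fun y : 'cV_n => entry_sum y) Mw; rewrite deflated_mul.
  rewrite entry_sumD !entry_sumZ entry_sum_const1 mulrAC divfK //.
  have -> : entry_sum (A *m v^T) = r * entry_sum v^T.
    rewrite !entry_sumE mulmxA -{1}A_sym -trmx_mul A_rows linearZ /=.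
    by rewrite -scalemxAl mxE.
  by lra.
exists v^T; split=> //.
- by apply: contra v0 => /eqP /(congr1 trmx); rewrite trmxK trmx0 => /eqP.
- by rewrite -Mw deflated_mul w0 mulr0 scale0r addr0.
Qed.

End Deflation.
End ConstantRowSums.

(** * The adjacency spectrum of a regular graph *)

Lemma sum_enum_val (V : nmodType) (T : finType) (F : T -> V) :
  \sum_(i < #|T|) F (enum_val i) = \sum_x F x.
Proof.
rewrite [RHS](reindex (enum_val : 'I_#|T| -> T)) //.
by apply: onW_bij; exact: enum_val_bij.
Qed.

Section RegularGraph.
Variables (R : realType) (G : sgraph) (r : nat).
Hypotheses (G_nonempty : (0 < #|G|)%N) (r_ge1 : (1 <= r)%N).
Hypothesis G_reg : regular G r.

Let n := #|G|.
Let A : 'M[R]_n := adjmx R G.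
Let lambda k := eig_desc A k.

Lemma adjmx_row_sum i : \sum_j A i j = r%:R.
Proof.
under eq_bigr do rewrite mxE.
rewrite (sum_enum_val (fun y => (adj (enum_val i) y)%:R)) -natr_sum.
rewrite -(G_reg (enum_val i)) /degree -sum1_card [in RHS]big_mkcond /=; congr _%:R.
by apply: eq_bigr => y _; rewrite inE; case: adj.
Qed.

Lemma adjmx_const1 : A *m const_mx 1 = r%:R *: (const_mx 1 : 'cV[R]_n).
Proof.
apply/matrixP => i j; rewrite mxE [RHS]mxE [_ i j in RHS]mxE mulr1.
by rewrite -(adjmx_row_sum i); apply: eq_bigr => k _; rewrite [X in _ * X]mxE mulr1.
Qed.

(** r |x|^2 + x^T A x and r |x|^2 - x^T A x are sums over the edges ij of
    (x_i + x_j)^2 and (x_i - x_j)^2. *)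
Lemma adjmx_qform_bound x : - (r%:R * sqnorm x) <= qform A x <= r%:R * sqnorm x.
Proof.
have sq : \sum_i \sum_j A i j * x i 0 ^+ 2 = r%:R * sqnorm x.
  rewrite mulr_sumr; apply: eq_bigr => i _.
  by rewrite -mulr_suml adjmx_row_sum.
have sq' : \sum_i \sum_j A i j * x j 0 ^+ 2 = r%:R * sqnorm x.
  rewrite exchange_big -sq; apply: eq_bigr => i _; apply: eq_bigr => j _.
  by rewrite !mxE adj_sym.
have key (e : R) : e ^+ 2 = 1 -> 0 <= r%:R * sqnorm x + e * qform A x.
  move=> e2; have sumE : \sum_i \sum_j A i j * (x i 0 + e * x j 0) ^+ 2 =
      r%:R * sqnorm x + r%:R * sqnorm x + 2 * e * qform A x.
    rewrite -{1}sq -sq' qformE mulr_sumr -!big_split /=.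
    apply: eq_bigr => i _; rewrite mulr_sumr -!big_split /=.
    by apply: eq_bigr => j _; rewrite sqrrD exprMn e2; ring.
  have : 0 <= \sum_i \sum_j A i j * (x i 0 + e * x j 0) ^+ 2.
    apply: sumr_ge0 => i _; apply: sumr_ge0 => j _.
    by rewrite mulr_ge0 ?sqr_ge0 // mxE ler0n.
  by rewrite sumE; lra.
have := key 1 (expr1n _ _); have := key (-1) (etrans (sqrrN 1) (expr1n _ _)).
by lra.
Qed.

Lemma card_vertex_gt1 : (1 < n)%N.
Proof.
have /card_gt0P[x _] : (0 < #|G|)%N := G_nonempty.
have : (0 < degree x)%N by rewrite G_reg.
case/card_gt0P=> y; rewrite inE => xy; rewrite /n (cardD1 x) inE (cardD1 y) !inE.
by case: eqP xy => // ->; rewrite adj_irr.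
Qed.

(** Here s lists lambda_2, ..., lambda_n.  It is nonempty because a vertex of
    positive degree has a neighbour, so that n > 1. *)
Lemma regular_spectrum : exists s : seq R,
  [/\ char_poly A = ('X - r%:R%:P) * \prod_(a <- s) ('X - a%:P),
      lambda 2 \in s, lambda n \in s,
      forall a, a \in s -> lambda n <= a <= lambda 2 &
      - r%:R <= lambda n /\ lambda 2 <= r%:R].
Proof.
have [sp_sorted charA] : is_spectrum A (spectrum A) := spectrumP (adjmx_sym R G).
have A_sym : A^T = A := adjmx_sym R G.
have size_sp : size (spectrum A) = n.
  by have := size_char_poly A; rewrite charA size_prod_XsubC => -[].
have sp_nth i j : (i <= j < n)%N -> (spectrum A)`_j <= (spectrum A)`_i.
  move=> /andP[ij jn].
  apply: (sorted_leq_nth _ _ _ sp_sorted) => //; rewrite ?inE ?size_sp //.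
  - by move=> y x z yx zy; apply: le_trans zy yx.
  - exact: leq_ltn_trans ij jn.
have bound a : a \in spectrum A -> - r%:R <= a <= r%:R.
  rewrite -root_prod_XsubC -charA -eigenvalue_root_char.
  case/eigenvalueP => v vA v0.
  have Av : A *m v^T = a *: v^T by rewrite -[in LHS]A_sym -trmx_mul vA linearZ.
  have vT0 : v^T != 0.
    by apply: contra v0 => /eqP /(congr1 trmx); rewrite trmxK trmx0 => /eqP.
  have := adjmx_qform_bound v^T.
  by rewrite (qform_eigenvector Av) -mulNr !ler_pM2r // sqnorm_gt0.
have r_in : r%:R \in spectrum A.
  rewrite -root_prod_XsubC -charA -eigenvalue_root_char.
  apply/eigenvalueP; exists (const_mx 1 : 'cV_n)^T.
    by rewrite -[in LHS]A_sym -trmx_mul adjmx_const1 linearZ.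
  apply/eqP => /matrixP /(_ 0 (Ordinal G_nonempty)); rewrite !mxE.
  by apply/eqP; exact: oner_neq0.
have n_gt1 := card_vertex_gt1.
(* r is an eigenvalue and none exceeds it, so it heads the sorted list. *)
have top : (spectrum A)`_0 = r%:R.
  have /bound/andP[_ top_le] : (spectrum A)`_0 \in spectrum A.
    by rewrite mem_nth // size_sp ltnW.
  apply/le_anti; rewrite top_le /=.
  by have /(nthP 0)[i i_lt <-] := r_in; rewrite sp_nth // -size_sp.
have spE : spectrum A = r%:R :: behead (spectrum A).
  move: top size_sp; case: (spectrum A) => [|a s] /= top size_s; last by rewrite top.
  by rewrite -size_s in n_gt1.
have in_s k : (0 < k < n)%N -> (spectrum A)`_k \in behead (spectrum A).
  case: k => // k /= k_lt; rewrite spE /= mem_nth // size_behead size_sp.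
  by rewrite -ltnS prednK // ltnW.
exists (behead (spectrum A)); split=> //.
- by rewrite charA {1}spE big_cons.
- by rewrite /lambda /eig_desc in_s.
- by rewrite /lambda /eig_desc in_s //; lia.
- move=> a /(nthP 0) [i i_lt <-]; rewrite size_behead size_sp in i_lt.
  rewrite nth_behead /lambda /eig_desc !sp_nth //; lia.
- have in_sp k : (0 < k < n)%N -> (spectrum A)`_k \in spectrum A.
    by move=> k_in; rewrite spE inE -spE in_s ?orbT.
  split.
    by have /bound/andP[] : lambda n \in spectrum A by apply: in_sp; lia.
  by have /bound/andP[] : lambda 2 \in spectrum A by apply: in_sp; lia.
Qed.

End RegularGraph.

(** * The Laplacian bound of a regular graph *)

Section RegularInvariants.
Variables (R : realType) (G : sgraph) (r : nat).
Hypotheses (G_nonempty : (0 < #|G|)%N) (r_ge1 : (1 <= r)%N).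
Hypothesis G_reg : regular G r.

Let n := #|G|.
Let A : 'M[R]_n := adjmx R G.
Let lambda k := eig_desc A k.

Lemma eig_asc_laplacian k : (0 < k <= n)%N ->
  eig_asc (laplacian R G) k = r%:R - lambda k.
Proof.
move=> /andP[k_gt0 k_le].
have [sp_sorted charA] : is_spectrum A (spectrum A) := spectrumP (adjmx_sym R G).
have size_sp : size (spectrum A) = n.
  by have := size_char_poly A; rewrite charA size_prod_XsubC => -[].
have LE : laplacian R G = r%:R%:M - A.
  congr (_ - _); apply/matrixP => i j; rewrite !mxE.
  by rewrite G_reg.
have specL : is_spectrum (laplacian R G)
    (rev [seq r%:R - a | a <- spectrum A]).
  split.
    rewrite rev_sorted sorted_map; apply: sub_sorted sp_sorted => a b /=.
    by rewrite lerD2l lerN2.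
  rewrite LE (char_poly_scalar_sub _ charA).
  by rewrite (perm_big _ (permEl (perm_rev _))) big_map.
rewrite /eig_asc (is_spectrum_uniq (spectrumP (laplacian_sym R G)) specL) revK.
by rewrite (nth_map 0) // size_sp -ltnS prednK.
Qed.

(** The quadratic form of A vanishes on a basis vector, as G has no loops, so
    its minimum over the unit sphere is at most 0. *)
Lemma lambda_n_le0 : lambda n <= 0.
Proof.
have n_gt1 := card_vertex_gt1 G_nonempty r_ge1 G_reg.
have [s [charA l2_in ln_in bd [_ l2_r]]] := regular_spectrum R G_nonempty r_ge1 G_reg.
pose x : 'cV[R]_n := delta_mx (Ordinal G_nonempty) 0.
have q0 : qform A x = 0.
  by rewrite /qform trmx_delta -rowE -colE !mxE adj_irr.
have x_gt0 : 0 < sqnorm x.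
  apply: sqnorm_gt0; apply/eqP => /matrixP /(_ (Ordinal G_nonempty) 0).
  by rewrite !mxE !eqxx; apply/eqP; exact: oner_neq0.
have /andP[+ _] : lambda n * sqnorm x <= qform A x <= r%:R * sqnorm x.
  apply: rayleigh (adjmx_sym R G) _ => a.
  rewrite charA rootM root_XsubC root_prod_XsubC => /orP[/eqP ->|/bd/andP[-> al2]].
    have /andP[ln_le_l2 _] := bd _ l2_in.
    by rewrite lexx andbT (le_trans ln_le_l2).
  exact: le_trans al2 l2_r.
by rewrite q0 pmulr_lle0.
Qed.

Lemma half_phiHE : 2^-1 * phiH R G =
  n%:R / 4 * ((lambda 2 - lambda n) / (r%:R - lambda n)).
Proof.
have n_gt1 := card_vertex_gt1 G_nonempty r_ge1 G_reg.
have r_gt0 : 0 < r%:R :> R by rewrite ltr0n.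
rewrite /phiH !eig_asc_laplacian ?n_gt1 ?leqnn ?andbT // -/n.
have := lambda_n_le0; set l2 := lambda 2; set ln := lambda n => ln_le0.
by field; rewrite gt_eqF // subr_gt0 (le_lt_trans ln_le0).
Qed.

End RegularInvariants.

(** * Feasibility for the extended bipartite double *)

Section ExtendedBipartiteDoubleForm.
Variables (R : realType) (G : sgraph).

Let n := #|G|.
Let A : 'M[R]_n := adjmx R G.

(** The quadratic form of J - 2 t (I + A). *)
Definition deviation (t : R) (p : 'cV[R]_n) : R :=
  entry_sum p ^+ 2 - 2 * t * (sqnorm p + qform A p).

Definition lhalf (x : 'cV[R]_#|B0 G|) : 'cV[R]_n :=
  \col_i x (enum_rank (inl (enum_val i) : B0 G)) 0.
Definition rhalf (x : 'cV[R]_#|B0 G|) : 'cV[R]_n :=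
  \col_i x (enum_rank (inr (enum_val i) : B0 G)) 0.

Lemma sum_B0 (F : G + G -> R) :
  \sum_(i < #|B0 G|) F (enum_val i) =
  \sum_(i < n) (F (inl (enum_val i)) + F (inr (enum_val i))).
Proof.
rewrite sum_enum_val big_sumType /= big_split /=.
by rewrite -!(sum_enum_val (fun x => F (_ x))).
Qed.

Lemma deviationE t p : deviation t p =
  \sum_i \sum_j (1 - 2 * t * ((i == j)%:R + A i j)) * (p i 0 * p j 0).
Proof.
have sumE : entry_sum p ^+ 2 = \sum_i \sum_j p i 0 * p j 0.
  by rewrite expr2 /entry_sum mulr_suml; apply: eq_bigr => i _; rewrite mulr_sumr.
rewrite /deviation sumE sqnormE_delta qformE -big_split mulr_sumr -sumrB /=.
apply: eq_bigr => i _; rewrite -big_split mulr_sumr -sumrB /=.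
by apply: eq_bigr => j _; ring.
Qed.

(** A_H and C exchange the two halves u and v of a vector, through I + A and
    J / 2.  A symmetric bilinear form satisfies
    4 b(u, v) = b(u + v, u + v) - b(u - v, u - v), so the two parts of the form
    decouple in the variables u + v and u - v, with opposite signs. *)
Lemma qform_B0 lam t x (p := lhalf x + rhalf x) (m := lhalf x - rhalf x) :
  4 * qform (lam%:M + t *: adjmx R (B0 G) - crossmx R (B0 G)) x =
  (2 * lam * sqnorm p - deviation t p) + (2 * lam * sqnorm m + deviation t m).
Proof.
pose f (a : G + G) := x (enum_rank (a : B0 G)) 0.
have xE i : x i 0 = f (enum_val i) by rewrite /f enum_valK.
pose K (a b : G + G) : R := lam * (a == b)%:R + t * (@adj (B0 G) a b)%:R -
  (if @side (B0 G) a != @side (B0 G) b then 2^-1 else 0).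
have -> : qform (lam%:M + t *: adjmx R (B0 G) - crossmx R (B0 G)) x =
    \sum_(i < #|B0 G|) \sum_(j < #|B0 G|)
      K (enum_val i) (enum_val j) * (f (enum_val i) * f (enum_val j)).
  rewrite qformE; apply: eq_bigr => i _; apply: eq_bigr => j _.
  by rewrite !xE !mxE /K (inj_eq enum_val_inj) !mulr_natr.
under eq_bigr do rewrite (sum_B0 (fun b => K _ b * (f _ * f b))).
rewrite (sum_B0 (fun a => \sum_j (K a _ * (f a * f _) + K a _ * (f a * f _)))).
rewrite !deviationE !sqnormE_delta !mulr_sumr -sumrB -!big_split /=.
apply: eq_bigr => i _; rewrite -!big_split /= !mulr_sumr -sumrB -!big_split /=.
apply: eq_bigr => j _.
have pE k : p k 0 = f (inl (enum_val k)) + f (inr (enum_val k)) by rewrite !mxE.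
have mE k : m k 0 = f (inl (enum_val k)) - f (inr (enum_val k)) by rewrite !mxE.
have adjE (k l : 'I_n) : ((enum_val k == enum_val l) ||
    adj (enum_val k) (enum_val l))%:R = (k == l)%:R + A k l :> R.
  rewrite mxE (inj_eq enum_val_inj); case: eqP => [->|_] /=; last by rewrite add0r.
  by rewrite adj_irr addr0.
have Asym : (j == i)%:R + A j i = (i == j)%:R + A i j.
  by rewrite eq_sym !mxE adj_sym.
have KE : [/\ K (inl (enum_val i)) (inl (enum_val j)) = lam * (i == j)%:R,
    K (inr (enum_val i)) (inr (enum_val j)) = lam * (i == j)%:R,
    K (inl (enum_val i)) (inr (enum_val j)) = t * ((i == j)%:R + A i j) - 2^-1 &
    K (inr (enum_val i)) (inl (enum_val j)) = t * ((i == j)%:R + A i j) - 2^-1].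
  rewrite /K /= !adjE Asym !mulr0 !addr0 !add0r !subr0.
  by split=> //; rewrite -(inj_eq enum_val_inj).
have [-> -> -> ->] := KE; rewrite !pE !mE; by field.
Qed.

(** The bounds on the deviation from above and from below come from the vectors
    whose halves are equal and opposite, respectively. *)
Lemma hhat_feasible_B0P lam t : hhat_feasible (B0 G) lam t <->
  forall p : 'cV[R]_n, `|deviation t p| <= 2 * lam * sqnorm p.
Proof.
split=> [[_ feas] p|dev].
  have join (u v : 'cV[R]_n) : exists x, lhalf x = u /\ rhalf x = v.
    exists (\col_i match enum_val i with
            | inl a => u (enum_rank a) 0 | inr b => v (enum_rank b) 0 end).
    by split; apply/matrixP => i j; rewrite ord1 !mxE enum_rankK enum_valK.
  have dev0 : deviation t 0 = 0.
    by rewrite deviationE big1 // => i _; rewrite big1 // => j _; rewrite !mxE; ring.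
  have norm0 : sqnorm (0 : 'cV[R]_n) = 0.
    by rewrite /sqnorm big1 // => i _; rewrite mxE expr0n.
  have [x [lx rx]] := join (2^-1 *: p) (2^-1 *: p).
  have [y [ly ry]] := join (2^-1 *: p) (- (2^-1 *: p)).
  have halves : 2^-1 *: p + 2^-1 *: p = p.
    by rewrite -scalerDl -[RHS]scale1r; congr (_ *: _); field.
  have := qform_B0 lam t x; rewrite lx rx subrr halves /= dev0 norm0 mulr0 !addr0.
  have := qform_B0 lam t y; rewrite ly ry subrr opprK halves /= dev0 norm0.
  have := feas x; have := feas y; rewrite -/(qform _ x) -/(qform _ y).
  by rewrite ler_norml; lra.
split.
  apply/matrixP => i j; rewrite !mxE adj_sym [j == i]eq_sym.
  by rewrite [side (enum_val j) == _]eq_sym.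
move=> x; rewrite -/(qform _ x) -(pmulr_rge0 _ (ltr0n R 4)) qform_B0.
move: (dev (lhalf x + rhalf x)) (dev (lhalf x - rhalf x)).
by rewrite !ler_norml; lra.
Qed.

End ExtendedBipartiteDoubleForm.

(** * The value of the relaxation, and the comparison *)

Section HhatExtendedDouble.
Variables (R : realType) (G : sgraph) (r : nat).
Hypotheses (G_nonempty : (0 < #|G|)%N) (r_ge1 : (1 <= r)%N).
Hypothesis G_reg : regular G r.

Let n := #|G|.
Let A : 'M[R]_n := adjmx R G.
Let lambda k := eig_desc A k.
Let theta : R := Num.max (lambda 2 + 1) (- lambda n - 1).

Lemma deviation_const1 t :
  deviation t (const_mx 1 : 'cV[R]_n) = n%:R * (n%:R - 2 * t * (r%:R + 1)).
Proof.
rewrite /deviation (qform_eigenvector (adjmx_const1 R G_reg)) entry_sum_const1.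
have -> : sqnorm (const_mx 1 : 'cV[R]_n) = n%:R.
  by rewrite -entry_sum_const1; apply: eq_bigr => i _; rewrite mxE expr1n.
by ring.
Qed.

Lemma deviation_eigenvector t a (w : 'cV[R]_n) : A *m w = a *: w ->
  entry_sum w = 0 -> deviation t w = - (2 * t * (a + 1)) * sqnorm w.
Proof. by move=> Aw w0; rewrite /deviation (qform_eigenvector Aw) w0; ring. Qed.

(** The optimal t balances the eigenvalue n - 2 t (r + 1) of J - 2 t (I + A) on
    the all-ones vector against the norm of this operator on the complement:
    both are then 2 t theta. *)
Lemma hhat_B0E : hhat R (B0 G) = n%:R / 2 * (theta / (theta + r%:R + 1)).
Proof.
have [s [charA l2_in ln_in bd [rln l2_r]]] :=
  regular_spectrum R G_nonempty r_ge1 G_reg.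
have ln_l2 : lambda n <= lambda 2 by have /andP[] := bd _ l2_in.
have A1 := adjmx_const1 R G_reg.
have A_sym : A^T = A := adjmx_sym R G.
have theta_l2 : lambda 2 + 1 <= theta by rewrite le_max lexx.
have theta_ln : - lambda n - 1 <= theta by rewrite le_max lexx orbT.
have theta_ge0 : 0 <= theta by lra.
have n_gt0 : 0 < n%:R :> R by rewrite ltr0n.
have r_gt0 : 0 < r%:R :> R by rewrite ltr0n.
have den_gt0 : 0 < theta + r%:R + 1 by lra.
have H_gt0 : (0 < #|B0 G|)%N by rewrite card_sum addn_gt0 G_nonempty.
have [[t feas] hhat_min] := hhatP R H_gt0.
apply/le_anti/andP; split.
  pose t0 : R := n%:R / 2 / (theta + r%:R + 1); apply: (hhat_min _ t0).
  have t0_ge0 : 0 <= t0 by rewrite !divr_ge0 ?ler0n // ltW.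
  have nE : n%:R = 2 * t0 * (theta + r%:R + 1) :> R.
    by rewrite /t0; field; rewrite gt_eqF.
  have -> : n%:R / 2 * (theta / (theta + r%:R + 1)) = t0 * theta.
    by rewrite /t0; field; rewrite gt_eqF.
  apply/hhat_feasible_B0P => p.
  have /andP[q_lo q_hi] :=
    qform_const_rows_bound G_nonempty A_sym A1 charA p ln_l2 bd.
  have c_le := mean_sq_le_sqnorm p G_nonempty.
  have sumE : entry_sum p ^+ 2 = n%:R * mean_sq p.
    by rewrite /mean_sq mulrC divfK // gt_eqF.
  have c_ge0 : 0 <= mean_sq p by rewrite divr_ge0 ?sqr_ge0.
  have -> : deviation t0 p = 2 * t0 *
      ((theta + r%:R + 1) * mean_sq p - sqnorm p - qform A p).
    by rewrite /deviation sumE nE; ring.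
  have -> : 2 * (t0 * theta) * sqnorm p = 2 * t0 * (theta * sqnorm p) by ring.
  have t02_ge0 : 0 <= 2 * t0 by rewrite mulr_ge0.
  rewrite normrM (ger0_norm t02_ge0) ler_wpM2l // ler_norml.
  move: q_lo q_hi c_le c_ge0; rewrite -/n -/A -/(lambda _) -/(lambda _).
  set c := mean_sq p; set N := sqnorm p; set q := qform A p.
  move=> q_lo q_hi c_le c_ge0.
  have lo_gap : (- lambda n - 1) * (N - c) <= theta * (N - c).
    by rewrite ler_wpM2r // subr_ge0.
  have hi_gap : (lambda 2 + 1) * (N - c) <= theta * (N - c).
    by rewrite ler_wpM2r // subr_ge0.
  have thc : 0 <= theta * c by rewrite mulr_ge0.
  by apply/andP; split; lra.
have dev := (hhat_feasible_B0P _ _ _).1 feas.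
set lam := hhat _ _ in dev *.
have const_bd : n%:R / 2 <= lam + t * (r%:R + 1).
  have := dev (const_mx 1); rewrite deviation_const1.
  have -> : sqnorm (const_mx 1 : 'cV[R]_n) = n%:R.
    by rewrite -entry_sum_const1; apply: eq_bigr => i _; rewrite mxE expr1n.
  rewrite normrM ger0_norm ?ler0n // [2 * lam * _]mulrC ler_pM2l // ler_norml.
  by lra.
have eig_bd a : a \in s -> `|t * (a + 1)| <= lam.
  case/(eigenvector_entry_sum0 G_nonempty A_sym A1 charA) => w [w0 sum0 Aw].
  have := dev w; rewrite (deviation_eigenvector _ Aw sum0) normrM.
  rewrite (ger0_norm (sqnorm_ge0 w)) ler_pM2r ?sqnorm_gt0 // normrN -mulrA.
  by rewrite normrM ger0_norm // ler_pM2l.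
have lam_theta : t * theta <= lam.
  have /andP[l2_lo l2_hi] : - lam <= t * (lambda 2 + 1) <= lam.
    by rewrite -ler_norml eig_bd.
  have /andP[ln_lo ln_hi] : - lam <= t * (lambda n + 1) <= lam.
    by rewrite -ler_norml eig_bd.
  have [->|->] : theta = lambda 2 + 1 \/ theta = - lambda n - 1.
  - by rewrite /theta; case: leP => _; [right | left].
  - by [].
  - by lra.
(* Eliminate t: theta times const_bd plus r + 1 times lam_theta. *)
rewrite mulrA ler_pdivrMr //.
have := ler_wpM2l theta_ge0 const_bd.
have := ler_wpM2r (_ : 0 <= r%:R + 1) lam_theta; rewrite ?addr_ge0 ?ler0n //.
by move=> /(_ isT); lra.
Qed.

End HhatExtendedDouble.

(** The case l2 = r belongs to theta = l2 + 1, because - r <= ln then gives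
    - ln - 1 < l2 + 1. *)
Lemma compare_bounds (R : realFieldType) (N r l2 ln : R)
    (theta := Num.max (l2 + 1) (- ln - 1))
    (f := N / 4 * ((l2 - ln) / (r - ln)))
    (h := N / 2 * (theta / (theta + r + 1))) :
  0 < N -> 0 < r -> - r <= ln -> ln <= 0 -> ln <= l2 -> l2 <= r ->
  f <= h /\ (f = h <-> l2 = r \/ l2 + ln + 2 = 0).
Proof.
move=> N_gt0 r_gt0 r_ln ln_le0 ln_l2 l2_r.
have rln_gt0 : 0 < r - ln by lra.
rewrite -subr_ge0; have fhE : f = h <-> h - f = 0.
  by split=> [->|/eqP]; rewrite ?subrr // subr_eq0 => /eqP ->.
rewrite fhE {fhE} /f /h /theta; case: (leP (l2 + 1) (- ln - 1)) => cmp.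
  have -> : N / 2 * ((- ln - 1) / (- ln - 1 + r + 1)) -
      N / 4 * ((l2 - ln) / (r - ln)) = N / 4 / (r - ln) * (- (l2 + ln + 2)).
    by field; lra.
  have c_gt0 : 0 < N / 4 / (r - ln) by rewrite !divr_gt0.
  split; first by rewrite mulr_ge0 ?(ltW c_gt0) //; lra.
  split=> [/eqP|eq0]; last by rewrite (_ : _ + 2 = 0) ?oppr0 ?mulr0 //; lra.
  by rewrite mulf_eq0 gt_eqF //= => /eqP ?; right; lra.
have -> : N / 2 * ((l2 + 1) / (l2 + 1 + r + 1)) -
    N / 4 * ((l2 - ln) / (r - ln)) =
    N / 4 / (r - ln) / (l2 + r + 2) * ((r - l2) * (l2 + ln + 2)).
  by field; lra.
have c_gt0 : 0 < N / 4 / (r - ln) / (l2 + r + 2) by rewrite !divr_gt0 //; lra.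
split; first by rewrite (mulr_ge0 (ltW c_gt0)) // mulr_ge0 //; lra.
split=> [/eqP|[->|->]]; rewrite ?subrr ?mul0r ?mulr0 //.
rewrite mulf_eq0 gt_eqF //= mulf_eq0 subr_eq0.
by case/orP=> /eqP; [left | right].
Qed.

Theorem proposition4p9 (R : realType) (G : sgraph) (r : nat)
    (G_nonempty : (0 < #|G|)%N) (r_ge1 : (1 <= r)%N) (G_reg : regular G r) :
  let lambda (k : nat) := eig_desc (adjmx R G) k in
  let n := #|G| in
  2^-1 * phiH R G <= hhat R (B0 G) /\
  (2^-1 * phiH R G = hhat R (B0 G) <->
   lambda 2%N = r%:R \/ lambda 2%N + lambda n + 2 = 0).
Proof.
move=> lambda n.
have [s [_ l2_in _ bd [r_ln l2_r]]] := regular_spectrum R G_nonempty r_ge1 G_reg.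
have /andP[ln_l2 _] := bd _ l2_in.
rewrite (half_phiHE R G_nonempty r_ge1 G_reg) (hhat_B0E R G_nonempty r_ge1 G_reg).
apply: compare_bounds; rewrite ?ltr0n //.
exact: lambda_n_le0 G_nonempty r_ge1 G_reg.
Qed.
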